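(* Let $G$ be a positive random variable on $E_A$ with $G\in L\log L(E_A)$. Then $$\mathbf E[G\log G]-\mathbf E[G]\log\mathbf E[G]\le\sum_{k\in A}\mathbf E\left[\frac{|D_kG|^2}{\mathbf E[G\,|\,\mathcal G_k]}\right].$$
   Context: $A$ is an at most countable set, $(E_a,\mathcal E_a,\mathbf P_a)_{a\in A}$ are Polish spaces with probability measures, $E_A=\prod_{a\in A}E_a$ carries the product $\sigma$-field and the product measure $\mathbf P=\otimes_{a\in A}\mathbf P_a$, with expectation $\mathbf E$. $X_a$ ($a\in A$) are the coordinate random variables. $\mathcal G_k=\sigma\{X_b,\ b\in A,\ b\neq k\}$, and the gradient is $$D_kG=G-\mathbf E[G\,|\,\mathcal G_k]=G(X_A)-\int_{E_k}G(X_{A\setminus\{k\}},x_k)\,d\mathbf P_k(x_k).$$ $G\in L\log L(E_A)$ means that $G$ and $G\log G$ are $\mathbf P$-integrable. The right-hand side takes values in $[0,+\infty]$. *)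

(* Defs.v *)
From HB Require Import structures.
From mathcomp Require Import all_boot all_order all_algebra finmap.
From mathcomp Require Import all_classical all_reals all_analysis.

Set Implicit Arguments.
Unset Strict Implicit.
Unset Printing Implicit Defensive.

Import Order.TTheory GRing.Theory Num.Theory.
Import numFieldNormedType.Exports.

Local Open Scope classical_set_scope.
Local Open Scope ring_scope.

(* The metric is existentially quantified: being Polish is a property of the
   topology alone. *)
Definition completely_metrizable (R : realType) (T : topologicalType) : Prop :=
  exists d : T -> T -> R,
    [/\ forall x y, d x y = 0 <-> x = y,
        forall x y, d x y = d y x,
        forall x y z, d x z <= d x y + d y z,
        forall (x : T) (U : set T),
          nbhs x U <-> exists2 e : R, 0 < e & [set y | d x y < e] `<=` U &
        forall u : nat -> T,
          (forall e : R, 0 < e -> exists N : nat,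
             forall m n, (N <= m)%N -> (N <= n)%N -> d (u m) (u n) < e) ->
          exists l : T, u @ \oo --> l].

Definition separable (T : topologicalType) : Prop :=
  exists2 D : set T, countable D & dense D.

Definition polish (R : realType) (T : topologicalType) : Prop :=
  completely_metrizable R T /\ separable T.

Notation borel T := (g_sigma_algebraType (@open T)).

(* The events [X_b \in B] for b in J and B Borel in E b. They generate
   sigma (X_b, b \in J). *)
Definition coord_events (A : countType) (E : A -> ptopologicalType)
    (J : set A) : set (set (forall a, E a)) :=
  \bigcup_(b in J) preimage_set_system [set: forall a, E a] (proj b)
    (measurable : set (set (borel (E b)))).

Arguments coord_events {A} E J.

Notation prod_space E := (g_sigma_algebraType (coord_events E setT)).

Definition sigma_but (A : countType) (E : A -> ptopologicalType) (k : A) :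
    set (set (prod_space E)) :=
  <<s coord_events E [set~ k] >>.
Arguments sigma_but {A} E k.

(* By the pi-lambda theorem the values on finite-dimensional rectangles
   determine the measure, so this characterizes the product of the Pa. *)
Definition is_product_measure (R : realType) (A : countType)
    (E : A -> ptopologicalType) (Pa : forall a, probability (borel (E a)) R)
    (P : probability (prod_space E) R) : Prop :=
  forall (J : {fset A}) (B : forall a, set (borel (E a))),
    (forall a, measurable (B a)) ->
    P [set x : prod_space E | forall a, a \in J -> B a (x a)] =
    (\prod_(a <- J) Pa a (B a))%E.

(* C is a version of the conditional expectation of X given the
   sub-sigma-algebra F. *)
Definition is_cond_exp d (T : measurableType d) (R : realType)
    (P : probability T R) (F : set (set T)) (X C : T -> R) : Prop :=
  [/\ P.-integrable [set: T] (EFin \o C),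
      forall B : set R, measurable B -> F (C @^-1` B) &
      forall S, F S ->
        (\int[P]_(x in S) (C x)%:E = \int[P]_(x in S) (X x)%:E)%E].

Definition LlogL d (T : measurableType d) (R : realType)
    (P : probability T R) (X : T -> R) : Prop :=
  P.-integrable [set: T] (EFin \o X) /\
  P.-integrable [set: T] (EFin \o (fun x => X x * ln (X x))).

(* D_k X = X - E[X | G_k], where C is a version of E[X | G_k]. *)
Definition gradient (T : Type) (R : realType) (X C : T -> R) (x : T) : R :=
  X x - C x.

(* Main.v *)
(** For [U > 0] depending on finitely many coordinates, average out these
    coordinates one at a time: [U = U_0, U_1, ..., U_n = E[U]].  Then
    [E[G ln U] - E[G] ln E[U]] telescopes into the sum of
    [E[G ln (U_{i-1} / U_i)]], and with [u = U_{i-1} / U_i] and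
    [C = E[G | G_k]], [k] being the coordinate averaged out at this step,
    [G ln u <= (G - C)^2 / C + C u - C].  The function [C / U_i] does not
    depend on the coordinate [k], so [E[C u] = E[C]], and each term of the
    sum is at most [E[(G - C)^2 / C]].  Such [U] are dense in
    [L^1((1 + |G|) P)], so that they can be made to approach [G], truncated
    to [[1/n, n]]; the entropy of [G] is the limit. *)

Require Import Defs.
From mathcomp Require Import all_boot all_order all_algebra finmap.
From mathcomp Require Import all_classical all_reals all_analysis.
From mathcomp Require Import measurable_realfun ring lra.

Set Implicit Arguments.
Unset Strict Implicit.
Unset Printing Implicit Defensive.

Import Order.TTheory GRing.Theory Num.Theory.
Import numFieldNormedType.Exports HBSimple HBNNSimple.

Local Open Scope classical_set_scope.
Local Open Scope ring_scope.

(** * Averaging out one coordinate *)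

Lemma measurable_invr (R : realType) : measurable_fun setT (@GRing.inv R).
Proof.
(* The square makes the base of the real power nonnegative and the factor [x] restores the sign; at
   [0] both sides are [0]. *)
have -> : @GRing.inv R = (fun x => x * (x ^+ 2) `^ (- 1)).
  apply/funext => x; rewrite powR_inv1 ?sqr_ge0//.
  have [->|x0] := eqVneq x 0; first by rewrite invr0 mul0r.
  by rewrite expr2 invfM mulrA divff// mul1r.
apply: measurable_funM; first exact: measurable_id.
have h2 : measurable_fun setT (fun x : R => x ^+ 2) by exact: measurable_funX.
exact: (measurableT_comp (measurable_powR (- 1)) h2).
Qed.

(* [r (x, y)] is [x] with one of its coordinates replaced by [y]. *)
Record resampling d d' (T : measurableType d) (Y : measurableType d')
    (R : realType) (P : probability T R) (Q : probability Y R)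
    (r : T * Y -> T) : Prop := Resampling {
  resampling_measurable : measurable_fun setT r ;
  resampling_law : forall S, measurable S -> P S = (P \x Q)%E (r @^-1` S) ;
  resamplingK : forall x y z, r (r (x, y), z) = r (x, z) }.

(** When [r] replaces the coordinate [k], this is the version of [E[U | G_k]] given by integrating
    that coordinate out. *)
Definition average d d' (T : measurableType d) (Y : measurableType d')
    (R : realType) (Q : probability Y R) (r : T * Y -> T) (U : T -> R) (x : T) :=
  \int[Q]_y U (r (x, y)).

(** [P] is the image of [P \x Q] under [r], so this is a change of variables followed by Tonelli's
    theorem. *)
Lemma integral_resample d d' (T : measurableType d) (Y : measurableType d')
    (R : realType) (P : probability T R) (Q : probability Y R)
    (r : T * Y -> T) (f : T -> \bar R) :
  resampling P Q r ->
  measurable_fun setT f -> (forall x, 0 <= f x)%E ->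
  (\int[P]_x f x = \int[P]_x \int[Q]_y f (r (x, y)))%E.
Proof.
move=> [mr hr _] mf f0.
rewrite (@eq_measure_integral _ _ _ setT (pushforward (P \x Q)%E r)); last first.
  by move=> S mS _; exact: hr.
rewrite ge0_integral_pushforward //.
rewrite preimage_setT fubini_tonelli1 //.
- exact: measurableT_comp.
- by move=> z; exact: f0.
Qed.

Lemma integrable_bounded d (T : measurableType d) (R : realType)
    (P : probability T R) (f : T -> R) (M : R) :
  measurable_fun setT f -> (forall x, `|f x| <= M) ->
  P.-integrable setT (EFin \o f).
Proof.
move=> mf fM; apply: measurable_bounded_integrable => //.
  by rewrite (le_lt_trans (probability_le1 _ _))// ltry.
exists M; split; first exact: num_real.
by move=> N MN x _ /=; rewrite (le_trans (fM x)) // ltW.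
Qed.

Lemma integrable_section d d' (T : measurableType d) (Y : measurableType d')
    (R : realType) (P : probability T R) (Q : probability Y R)
    (r : T * Y -> T) (U : T -> R) (M : R) (x : T) :
  resampling P Q r -> measurable_fun setT U -> (forall x, 0 <= U x <= M) ->
  Q.-integrable setT (EFin \o (fun y => U (r (x, y)))).
Proof.
move=> [mr _ _] mU hU; apply: (@integrable_bounded _ _ _ _ _ M).
  by apply: measurableT_comp => //; apply: measurableT_comp.
move=> y; have /andP[h1 h2] := hU (r (x, y)).
by rewrite ger0_norm.
Qed.

Lemma measurable_average d d' (T : measurableType d) (Y : measurableType d')
    (R : realType) (P : probability T R) (Q : probability Y R)
    (r : T * Y -> T) (U : T -> R) :
  resampling P Q r -> measurable_fun setT U -> (forall x, 0 <= U x) ->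
  measurable_fun setT (average Q r U).
Proof.
move=> [mr _ _] mU U0.
have -> : average Q r U = fine \o fubini_F Q (EFin \o (U \o r)) by [].
apply: (measurableT_comp (@fine_measurable R setT measurableT)).
apply: measurable_fun_fubini_tonelli_F.
  by apply/measurable_EFinP; exact: measurableT_comp.
by move=> z; rewrite lee_fin /=.
Qed.

Lemma average_bounds d d' (T : measurableType d) (Y : measurableType d')
    (R : realType) (P : probability T R) (Q : probability Y R)
    (r : T * Y -> T) (U : T -> R) (m M : R) (x : T) :
  resampling P Q r -> measurable_fun setT U -> 0 <= m ->
  (forall x, m <= U x <= M) -> m <= average Q r U x <= M.
Proof.
move=> hr mU m0 hU.
have hU0 z : 0 <= U z <= M by have := hU z; lra.
have iU := integrable_section x hr mU hU0.
have iC c : Q.-integrable setT (EFin \o cst c).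
  by apply: finite_measure_integrable_cst.
have EC c : \int[Q]_y (cst c y) = c.
  rewrite Rintegral_cst//; transitivity (c * fine (1%E : \bar R));
    last by rewrite mulr1.
  congr (_ * fine _).
  exact: probability_setT.
by apply/andP; split; [rewrite -[leLHS]EC|rewrite -[leRHS]EC];
  apply: le_Rintegral => // y _; have /andP[] := hU (r (x, y)).
Qed.

Lemma average_resample d d' (T : measurableType d) (Y : measurableType d')
    (R : realType) (P : probability T R) (Q : probability Y R)
    (r : T * Y -> T) (U : T -> R) (x : T) (y : Y) :
  resampling P Q r -> average Q r U (r (x, y)) = average Q r U x.
Proof.
by move=> [_ _ rK]; apply: eq_Rintegral => z _; rewrite rK.
Qed.

(** After resampling, [W] is constant in the new coordinate and leaves the inner integral, where
    only the average of [U] remains. *)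
Lemma integral_invariantM d d' (T : measurableType d) (Y : measurableType d')
    (R : realType) (P : probability T R) (Q : probability Y R)
    (r : T * Y -> T) (U W : T -> R) (M : R) :
  resampling P Q r -> measurable_fun setT U -> (forall x, 0 <= U x <= M) ->
  measurable_fun setT W -> (forall x, 0 <= W x) ->
  (forall x y, W (r (x, y)) = W x) ->
  (\int[P]_x (W x * U x)%:E = \int[P]_x (W x * average Q r U x)%:E)%E.
Proof.
move=> hr mU hU mW W0 hW.
rewrite (integral_resample hr (f := fun x => (W x * U x)%:E)).
- apply: eq_integral => x _.
  under eq_integral do rewrite hW EFinM.
  have iU := integrable_section x hr mU hU.
  rewrite integralZl// EFinM; congr (_ * _)%E.
  by rewrite /average fineK //; exact: integrable_fin_num.
- by apply/measurable_EFinP; exact: measurable_funM.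
- by move=> x; rewrite lee_fin mulr_ge0//; have /andP[] := hU x.
Qed.

(* The bound is [g ln u = g ln (u c / g) + g ln (g / c)] combined with
   [ln t <= t - 1], applied twice. *)
Lemma gibbs_pointwise (R : realType) (g c u : R) : 0 < g -> 0 < c -> 0 < u ->
  g * ln u + (c - c * u) <= `|g - c| ^+ 2 / c.
Proof.
move=> g0 c0 u0.
have ln_le (t : R) : 0 < t -> ln t <= t - 1.
  by move=> t0; rewrite -{1}(subrK 1 t) addrC le_ln1Dx //; lra.
have h1 := ln_le _ (divr_gt0 (mulr_gt0 u0 c0) g0).
have h2 := ln_le _ (divr_gt0 g0 c0).
have e : ln u = ln (u * c / g) + ln (g / c).
  rewrite -lnM ?posrE ?divr_gt0 ?mulr_gt0//; congr ln.
  by field; rewrite !gt_eqF.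
have h3 : g * ln u <= g * ((u * c / g - 1) + (g / c - 1)).
  by rewrite ler_pM2l// e lerD.
rewrite real_normK ?num_real//.
have -> : (g - c) ^+ 2 / c = g * ((u * c / g - 1) + (g / c - 1)) + (c - c * u).
  by field; rewrite !gt_eqF.
by rewrite lerD2r.
Qed.

(** The integral of [h] may be infinite, so the comparison runs through nonnegative functions:
    [f <= max f 0] everywhere, and [max f 0 <= |h| = h] almost everywhere. *)
Lemma integral_le_ae d (T : measurableType d) (R : realType)
    (P : probability T R) (f h : T -> R) :
  P.-integrable setT (EFin \o f) -> measurable_fun setT h ->
  {ae P, forall x, f x <= h x} -> {ae P, forall x, 0 <= h x} ->
  (\int[P]_x (f x)%:E <= \int[P]_x (h x)%:E)%E.
Proof.
move=> fint mh fh h0.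
have mf : measurable_fun setT f.
  by apply/measurable_EFinP; exact: measurable_int fint.
have -> : (\int[P]_x (h x)%:E = \int[P]_x (`|h x|)%:E)%E.
  apply: ae_eq_integral => //; [exact/measurable_EFinP| |].
    by apply/measurable_EFinP; exact: measurableT_comp.
  by apply: filterS h0 => x hx _; rewrite ger0_norm.
apply: (@le_trans _ _ (\int[P]_x (Num.max (f x) 0)%:E)%E).
  apply: le_integral => //.
    apply: (le_integrable _ _ _ fint) => //.
      by apply/measurable_EFinP; exact: measurable_maxr.
    move=> x _ /=; rewrite lee_fin.
    by case: (leP (f x) 0) => f0; rewrite ?normr0.
  by move=> x _; rewrite lee_fin le_max lexx.
apply: ae_ge0_le_integral => //.
- by move=> x _; rewrite lee_fin le_max lexx orbT.
- by apply/measurable_EFinP; exact: measurable_maxr.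
- by apply/measurable_EFinP; exact: measurableT_comp.
- apply: filterS2 fh h0 => x h1 h2 _; rewrite lee_fin ge_max normr_ge0 andbT.
  by rewrite ger0_norm.
Qed.

Lemma integrableM_bounded d (T : measurableType d) (R : realType)
    (P : probability T R) (f g : T -> R) (M : R) :
  P.-integrable setT (EFin \o f) -> measurable_fun setT g ->
  (forall x, `|g x| <= M) ->
  P.-integrable setT (EFin \o (fun x => f x * g x)).
Proof.
move=> fi mg gM; have mf : measurable_fun setT f.
  by apply/measurable_EFinP; exact: measurable_int fi.
apply: (le_integrable _ _ _ (integrableZl measurableT M fi)) => //.
  by apply/measurable_EFinP; exact: measurable_funM.
move=> x _; rewrite /= lee_fin !normrM mulrC ler_wpM2r//.
by rewrite (le_trans (gM x)) ?ler_norm.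
Qed.

Lemma integrableM_ln d (T : measurableType d) (R : realType)
    (P : probability T R) (G U : T -> R) (m M : R) :
  P.-integrable setT (EFin \o G) -> measurable_fun setT U -> 0 < m ->
  (forall x, m <= U x <= M) ->
  P.-integrable setT (EFin \o (fun x => G x * ln (U x))).
Proof.
move=> iG mU m0 hU.
apply: (@integrableM_bounded _ _ _ _ _ _ (`|ln m| + `|ln M|)) => //.
  exact: measurableT_comp.
move=> x; have /andP[h1 h2] := hU x.
have h3 : ln m <= ln (U x) by rewrite ler_ln ?posrE; lra.
have h4 : ln (U x) <= ln M by rewrite ler_ln ?posrE; lra.
have := ler_norm (ln M); have := ler_norm (- ln m); rewrite normrN.
have := normr_ge0 (ln m); have := normr_ge0 (ln M).
by rewrite ler_norml => *; apply/andP; split; lra.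
Qed.

(** This bounds one term of the telescoping sum. A correction of zero integral is added to the left
    integrand, after which [gibbs_pointwise] compares the integrands almost everywhere. The right
    side may be infinite. *)
Lemma entropy_step d d' (T : measurableType d) (Y : measurableType d')
    (R : realType) (P : probability T R) (Q : probability Y R)
    (r : T * Y -> T) (G C U : T -> R) (m M : R) :
  resampling P Q r ->
  P.-integrable setT (EFin \o G) -> {ae P, forall x, 0 < G x} ->
  P.-integrable setT (EFin \o C) -> {ae P, forall x, 0 < C x} ->
  (forall x y, C (r (x, y)) = C x) ->
  measurable_fun setT U -> 0 < m -> (forall x, m <= U x <= M) ->
  (\int[P]_x (G x * (ln (U x) - ln (average Q r U x)))%:E <=
   \int[P]_x (`|G x - C x| ^+ 2 / C x)%:E)%E.
Proof.
move=> hr iG G0 iC C0 hC mU m0 hU.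
have hA x : m <= average Q r U x <= M by exact: average_bounds hr mU (ltW m0) hU.
have Upos x : 0 < U x by have := hU x; lra.
have Apos x : 0 < average Q r U x by have := hA x; lra.
have hU0 x : 0 <= U x <= M by have := hU x; lra.
have mA : measurable_fun setT (average Q r U).
  by apply: measurable_average hr mU _ => x; exact: ltW.
have mG : measurable_fun setT G.
  by apply/measurable_EFinP; exact: measurable_int iG.
have mC : measurable_fun setT C.
  by apply/measurable_EFinP; exact: measurable_int iC.
have mlnU : measurable_fun setT (fun x => ln (U x)).
  exact: measurableT_comp.
have mlnA : measurable_fun setT (fun x => ln (average Q r U x)).
  exact: measurableT_comp.
pose u x := U x / average Q r U x.
have mVA : measurable_fun setT (fun x => (average Q r U x)^-1).
  exact: measurableT_comp (@measurable_invr R) mA.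
have mu : measurable_fun setT u by exact: measurable_funM.
have upos x : 0 < u x by rewrite divr_gt0.
have iGu : P.-integrable setT
    (EFin \o (fun x => G x * (ln (U x) - ln (average Q r U x)))).
  (* Both logarithms lie in the interval from [ln m] to [ln M], whose length bounds their
     difference. *)
  apply: (@integrableM_bounded _ _ _ _ _ _ (ln M - ln m)) => //.
    exact: measurable_funB.
  move=> x; have /andP[a1 a2] := hU x; have /andP[b1 b2] := hA x.
  have M0 : 0 < M by lra.
  have : ln m <= ln (U x) by rewrite ler_ln ?posrE.
  have : ln (U x) <= ln M by rewrite ler_ln ?posrE.
  have : ln m <= ln (average Q r U x) by rewrite ler_ln ?posrE.
  have : ln (average Q r U x) <= ln M by rewrite ler_ln ?posrE.
  by rewrite ler_norml; lra.
(* [|C|] replaces [C], which is positive only almost everywhere, because Tonelli's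
   theorem is used for nonnegative functions. *)
have iCn : P.-integrable setT (EFin \o (fun x => `|C x|)).
  exact: integrable_abse iC.
have iCu : P.-integrable setT (EFin \o (fun x => `|C x| * u x)).
  apply: (@integrableM_bounded _ _ _ _ _ _ (M / m)) => // x.
  rewrite ger0_norm ?(ltW (upos x))//.
  have /andP[a1 a2] := hU x; have /andP[b1 b2] := hA x.
  by rewrite ler_pM ?invr_ge0 ?(ltW (Upos x)) ?(ltW (Apos x))// lef_pV2 ?posrE.
(* The weight [|C| / average Q r U] is invariant under resampling, so [U] may be replaced by its
   average, which cancels the denominator. *)
have eC : (\int[P]_x (`|C x| * u x)%:E = \int[P]_x (`|C x|)%:E)%E.
  under eq_integral do rewrite /u mulrCA mulrC.
  rewrite (integral_invariantM hr (W := fun x => `|C x| / average Q r U x) mU hU0).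
  - by apply: eq_integral => x _; rewrite divfK // gt_eqF.
  - by apply: measurable_funM => //; exact: measurableT_comp.
  - by move=> x; rewrite divr_ge0// ltW.
  - by move=> x y; rewrite hC (average_resample _ _ _ hr).
(* By [eC] the added term [|C| - |C| u] integrates to zero; it completes the left side of
   [gibbs_pointwise]. *)
have -> : (\int[P]_x (G x * (ln (U x) - ln (average Q r U x)))%:E =
    \int[P]_x (G x * (ln (U x) - ln (average Q r U x)) +
      (`|C x| - `|C x| * u x))%:E)%E.
  under [RHS]eq_integral do rewrite EFinD EFinB.
  rewrite integralD//; last exact: integrableB.
  rewrite integralB// eC subee ?adde0//.
  exact: integrable_fin_num.
apply: integral_le_ae.
- exact: (integrableD measurableT iGu (integrableB measurableT iCn iCu)).
- apply: measurable_funM; last exact: measurableT_comp (@measurable_invr R) mC.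
  by apply: measurable_funX; apply: measurableT_comp => //; exact: measurable_funB.
- apply: filterS2 G0 C0 => x g0 c0; rewrite (gtr0_norm c0) -ln_div ?posrE//.
  by apply: gibbs_pointwise => //; exact: upos.
- by apply: filterS C0 => x c0; rewrite divr_ge0// ltW.
Qed.

(** * Density in a weighted L^1 space *)

Definition bounded_measurable d (T : measurableType d) (R : realType) :
    set (T -> R) :=
  [set f : T -> R | measurable_fun setT f /\ exists M, forall x, `|f x| <= M].

(* [f] is in the closure of [F] in L^1 of the measure with density [W]. *)
Definition approximable d (T : measurableType d) (R : realType)
    (P : probability T R) (W : T -> R) (F : set (T -> R)) : set (T -> R) :=
  [set f : T -> R | bounded_measurable f /\ forall e, 0 < e ->
    exists2 U, F U & \int[P]_x (W x * `|f x - U x|) < e].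

Lemma integrable_weighted_dist d (T : measurableType d) (R : realType)
    (P : probability T R) (W f g : T -> R) :
  P.-integrable setT (EFin \o W) ->
  bounded_measurable f -> bounded_measurable g ->
  P.-integrable setT (EFin \o (fun x => W x * `|f x - g x|)).
Proof.
move=> iW [mf [M hM]] [mg [N hN]].
apply: (@integrableM_bounded _ _ _ _ _ _ (M + N)) => //.
  by apply: measurableT_comp => //; exact: measurable_funB.
by move=> x; rewrite normr_id (le_trans (ler_normB _ _))// lerD.
Qed.

Lemma weighted_dist_triangle d (T : measurableType d) (R : realType)
    (P : probability T R) (W f g h : T -> R) (a b : R) :
  P.-integrable setT (EFin \o W) -> (forall x, 0 <= W x) ->
  bounded_measurable f -> bounded_measurable g -> bounded_measurable h ->
  \int[P]_x (W x * `|f x - g x|) < a -> \int[P]_x (W x * `|g x - h x|) < b ->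
  \int[P]_x (W x * `|f x - h x|) < a + b.
Proof.
move=> iW W0 bf bg bh ha hb; apply: le_lt_trans (ltrD ha hb).
have i1 := integrable_weighted_dist iW bf bg.
have i2 := integrable_weighted_dist iW bg bh.
rewrite -RintegralD//; apply: le_Rintegral => //.
- exact: integrable_weighted_dist.
- exact: (integrableD measurableT i1 i2).
- by move=> x _; rewrite -mulrDr ler_wpM2l// ler_distD.
Qed.

Lemma bounded_measurableD d (T : measurableType d) (R : realType)
    (f g : T -> R) (c : R) :
  bounded_measurable f -> bounded_measurable g ->
  bounded_measurable (fun x => f x + c * g x).
Proof.
move=> [mf [M hM]] [mg [N hN]]; split.
  by apply: measurable_funD => //; exact: measurable_funM.
exists (M + `|c| * N) => x; rewrite (le_trans (ler_normD _ _))// lerD//.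
by rewrite normrM ler_wpM2l.
Qed.

Lemma approximableD d (T : measurableType d) (R : realType)
    (P : probability T R) (W : T -> R) (F : set (T -> R)) (f g : T -> R) (c : R) :
  P.-integrable setT (EFin \o W) -> (forall x, 0 <= W x) ->
  (forall u, F u -> bounded_measurable u) ->
  (forall u v c, F u -> F v -> F (fun x => u x + c * v x)) ->
  approximable P W F f -> approximable P W F g ->
  approximable P W F (fun x => f x + c * g x).
Proof.
move=> iW W0 Fb FD [bf hf] [bg hg]; split; first exact: bounded_measurableD.
(* The [+ 1] keeps the divisor positive when [c = 0]. *)
move=> e e0; have c0 : 0 < `|c| + 1 by rewrite ltr_wpDl.
have [U FU hU] := hf (e / 2) ltac:(lra).
have [V FV hV] := hg (e / 2 / (`|c| + 1)) ltac:(by rewrite !divr_gt0).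
exists (fun x => U x + c * V x); first exact: FD.
have i1 := integrable_weighted_dist iW bf (Fb _ FU).
have i2 := integrable_weighted_dist iW bg (Fb _ FV).
apply: (@le_lt_trans _ _ (\int[P]_x (W x * `|f x - U x|) +
   (`|c| + 1) * \int[P]_x (W x * `|g x - V x|))); last first.
  move: hV; rewrite ltr_pdivlMr// mulrC => hV.
  by rewrite [ltRHS](_ : e = e / 2 + e / 2) ?ltrD//; lra.
have i3 := integrableZl measurableT (`|c| + 1) i2.
rewrite -RintegralZl// -RintegralD//.
apply: le_Rintegral => //.
- apply: integrable_weighted_dist => //; first exact: bounded_measurableD.
  by apply: bounded_measurableD; exact: Fb.
- exact: (integrableD measurableT i1 i3).
- move=> x _; rewrite mulrCA -mulrDr ler_wpM2l//.
  have -> : f x + c * g x - (U x + c * V x) = (f x - U x) + c * (g x - V x).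
    by ring.
  rewrite (le_trans (ler_normD _ _))// lerD// normrM ler_wpM2r//.
  by rewrite lerDl.
Qed.

(** Dominated convergence with majorant [2 K W] puts some [f_ N] within [e / 2] of [f], and [f_ N]
    is itself within [e / 2] of an element of [F]. *)
Lemma approximable_lim d (T : measurableType d) (R : realType)
    (P : probability T R) (W : T -> R) (F : set (T -> R))
    (f_ : (T -> R)^nat) (f : T -> R) (K : R) :
  P.-integrable setT (EFin \o W) -> (forall x, 0 <= W x) ->
  (forall u, F u -> bounded_measurable u) ->
  (forall n, approximable P W F (f_ n)) ->
  (forall x, f_ n x @[n --> \oo] --> f x) ->
  (forall n x, `|f_ n x| <= K) ->
  approximable P W F f.
Proof.
move=> iW W0 Fb Af cf hK.
have mf_ n : measurable_fun setT (f_ n) by case: (Af n) => -[].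
have mf : measurable_fun setT f.
  by apply: (measurable_fun_cvg mf_) => x _; exact: cf.
have fK x : `|f x| <= K.
  have h : `|f_ n x| @[n --> \oo] --> `|f x| by apply: cvg_norm; exact: cf.
  rewrite -(cvg_lim _ h)//; apply: limr_le; first by apply/cvg_ex; eexists; exact: h.
  by apply: nearW => n; exact: hK.
have bf : bounded_measurable f by split => //; exists K.
split => // e e0.
have [|||||] := @dominated_convergence _ T R P setT measurableT
  (fun n x => (W x * `|f_ n x - f x|)%:E) (cst 0%E)
  (fun x => ((2 * K)%:E * (W x)%:E)%E).
- move=> n; apply/measurable_EFinP; apply: measurable_funM.
    by apply/measurable_EFinP; exact: measurable_int iW.
  by apply: measurableT_comp => //; exact: measurable_funB.
- exact: measurable_cst.
- apply: aeW => x _; apply: cvg_EFin; first by apply: nearW.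
  rewrite -(mulr0 (W x)); apply: cvgMr; rewrite -(@normr0 _ R).
  apply: cvg_norm; rewrite -(subrr (f x)); apply: cvgB; [exact: cf|exact: cvg_cst].
- exact: integrableZl.
- apply: aeW => x n _; rewrite lee_fin ger0_norm ?mulr_ge0// mulrC ler_wpM2r//.
  by rewrite (le_trans (ler_normB _ _))// (le_trans (lerD (hK n x) (fK x)))//; lra.
move=> _ _; rewrite integral0 => /fine_cvg /cvgr_lt /(_ (e / 2) ltac:(lra)).
move=> [N _ /(_ N (leqnn N)) /= hN].
have [bN /(_ (e / 2) ltac:(lra)) [U FU hU]] := Af N.
exists U => //; rewrite [ltRHS](_ : e = e / 2 + e / 2); last by lra.
apply: weighted_dist_triangle hU => //; [exact: Fb|].
by move: hN; under eq_Rintegral do rewrite distrC.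
Qed.

(** Dynkin's pi-lambda theorem: the measurable sets with approximable indicator form a lambda-system
    that contains the pi-system [G]. *)
Lemma approximable_indic d (T : measurableType d) (R : realType)
    (P : probability T R) (W : T -> R) (F : set (T -> R)) (G : set (set T))
    (S : set T) :
  P.-integrable setT (EFin \o W) -> (forall x, 0 <= W x) ->
  (forall u, F u -> bounded_measurable u) ->
  (forall u v c, F u -> F v -> F (fun x => u x + c * v x)) ->
  d.-measurable = <<s G >> -> setI_closed G -> G setT ->
  (forall B, G B -> F \1_B) ->
  measurable S -> approximable P W F \1_S.
Proof.
move=> iW W0 Fb FD mG GI GT GF mS.
have FA u : F u -> approximable P W F u.
  move=> Fu; split; first exact: Fb.
  move=> e e0; exists u => //.
  under eq_Rintegral do rewrite subrr normr0 mulr0.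
  by rewrite Rintegral_cst// mul0r.
suff /(_ S) [] : <<s G >> `<=` [set B | measurable B /\ approximable P W F \1_B].
  by rewrite -mG.
  by [].
apply: lambda_system_subset => //.
- split.
  + by [].
  + by split => //; exact: FA (GF _ GT).
  + move=> A B BA [mA aA] [mB aB]; split; first exact: measurableD.
    have -> : \1_(A `\` B) = (fun x => \1_A x + (-1) * \1_B x) :> (T -> R).
      apply/funext => x; rewrite !indicE in_setD.
      have [xB|xB] := boolP (x \in B).
        have -> : x \in A by move: xB; rewrite !inE; exact: BA.
        by rewrite /= mulr1 subrr.
      by rewrite andbT mulr0 addr0.
    exact: approximableD.
  + move=> B ndB hB; split.
      by apply: bigcup_measurable => n _; case: (hB n).
    (* Along an increasing union the indicators are eventually constant at each point, and they are
       bounded by [1]. *)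
    apply: (@approximable_lim _ _ _ _ _ _ (fun n => \1_(B n)) _ 1) => //.
    * by move=> n; case: (hB n).
    * move=> x; apply: cvg_near_cst.
      have [[n _ Bnx]|nB] := pselect ((\bigcup_n B n) x); last first.
        apply: nearW => n; rewrite !indicE !memNset// => Bnx.
        by apply: nB; exists n.
      exists n => // k /= nk; rewrite !indicE !mem_set//; first by exists n.
      have := ndB _ _ nk; rewrite subsetEset; exact.
    * by move=> n x; rewrite indicE ger0_norm ?ler0n// lern1 leq_b1.
- by move=> B GB; split; [rewrite mG; exact: sub_sigma_algebra|exact: FA (GF _ GB)].
Qed.

(** Linearity extends the approximation from indicators to simple functions, and [f] is a bounded
    limit of simple functions. *)
Lemma approximable_bounded d (T : measurableType d) (R : realType)
    (P : probability T R) (W : T -> R) (F : set (T -> R)) (G : set (set T))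
    (f : T -> R) (M : R) :
  P.-integrable setT (EFin \o W) -> (forall x, 0 <= W x) ->
  (forall u, F u -> bounded_measurable u) ->
  (forall u v c, F u -> F v -> F (fun x => u x + c * v x)) ->
  d.-measurable = <<s G >> -> setI_closed G -> G setT ->
  (forall B, G B -> F \1_B) ->
  measurable_fun setT f -> (forall x, 0 <= f x <= M) -> approximable P W F f.
Proof.
move=> iW W0 Fb FD mG GI GT GF mf fM.
have A1 S : measurable S -> approximable P W F \1_S.
  by move=> mS; exact: (approximable_indic iW W0 Fb FD mG).
have Asum (s : seq R) (g : {sfun T >-> R}) :
    approximable P W F (fun x => \sum_(y <- s) y * \1_(g @^-1` [set y]) x).
  elim: s => [|y s IHs].
    (* The zero function is written as a combination of indicators, to which [approximableD]
       applies. *)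
    have -> : (fun x => \sum_(y <- [::]) y * \1_(g @^-1` [set y]) x) =
        (fun x : T => \1_[set: T] x + (-1) * \1_[set: T] x).
      by apply/funext => x; rewrite big_nil mulN1r subrr.
    by apply: approximableD => //; exact: A1.
  have -> : (fun x => \sum_(y <- y :: s) y * \1_(g @^-1` [set y]) x) =
      (fun x => \sum_(y <- s) y * \1_(g @^-1` [set y]) x +
         y * \1_(g @^-1` [set y]) x).
    by apply/funext => x; rewrite big_cons addrC.
  by apply: approximableD => //; exact: A1.
have Asf (g : {sfun T >-> R}) : approximable P W F g.
  have -> : (g : T -> R) =
      (fun x => \sum_(y <- fset_set (range g)) y * \1_(g @^-1` [set y]) x).
    by apply/funext => x; rewrite {1}fimfunE fsbig_finite.
  exact: Asum.
have mEf : measurable_fun setT (EFin \o f) by exact/measurable_EFinP.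
pose g_ := nnsfun_approx measurableT mEf.
have cg x : g_ n x @[n --> \oo] --> f x.
  apply: (@fine_cvg _ _ _ _ (fun n => (g_ n x)%:E)).
  by apply: cvg_nnsfun_approx => // y _; rewrite lee_fin; have /andP[] := fM y.
apply: (@approximable_lim _ _ _ _ _ _ (fun n => g_ n) _ M) => // n x.
rewrite ger0_norm ?fun_ge0//; have /andP[_] := fM x; apply: le_trans.
(* The approximations increase to [f], hence stay below [f] and so below [M]. *)
have ndg : nondecreasing_seq (fun n => g_ n x).
  by move=> i j ij; have /lefP := nd_nnsfun_approx measurableT mEf ij; exact.
rewrite -(cvg_lim _ (cg x))//; apply: nondecreasing_cvgn_le => //.
by apply/cvg_ex; eexists; exact: cg.
Qed.

(** * Entropy as a limit *)

(** The integral of [|f|] over [S] vanishes, so [f = 0] almost everywhere on [S], which conflicts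
    with [f > 0]. The lemma later gives the positivity of the conditional expectations. *)
Lemma ae_notin_of_integral_le0 d (T : measurableType d) (R : realType)
    (P : probability T R) (f : T -> R) (S : set T) :
  measurable S -> measurable_fun setT f -> {ae P, forall x, 0 < f x} ->
  (\int[P]_(x in S) (f x)%:E <= 0)%E -> {ae P, forall x, ~ S x}.
Proof.
move=> mS mf f0 If.
have mES : measurable_fun S (EFin \o f).
  by apply/measurable_EFinP; exact: measurable_funTS.
have abs0 : (\int[P]_(x in S) `|(f x)%:E| = 0)%E.
  apply/eqP; rewrite eq_le integral_ge0// andbT.
  apply: le_trans If; rewrite le_eqVlt; apply/orP; left; apply/eqP.
  apply: ae_eq_integral => //; first exact: measurableT_comp.
  by apply: filterS f0 => x fx _ /=; rewrite gtr0_norm.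
have /(ae_eq_integral_abs P mS mES) f00 := abs0.
by apply: filterS2 f0 f00 => x fx h Sx; move: (h Sx) fx => -[->]; rewrite ltxx.
Qed.

Lemma Rintegral_gt0 d (T : measurableType d) (R : realType)
    (P : probability T R) (f : T -> R) :
  P.-integrable setT (EFin \o f) -> {ae P, forall x, 0 < f x} ->
  0 < \int[P]_x f x.
Proof.
move=> fi f0; rewrite ltNge; apply/negP => fle.
have mf : measurable_fun setT f.
  by apply/measurable_EFinP; exact: measurable_int fi.
have P0 : (P setT > 0)%E by rewrite probability_setT.
have : {ae P, forall x, ~ [set: T] x}.
  apply: (ae_notin_of_integral_le0 measurableT mf f0).
  by rewrite -(fineK (integrable_fin_num measurableT fi)) lee_fin.
by move=> /(@filter_ex _ _ (ae_properfilter_algebraOfSetsType P0))[x]; apply.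
Qed.

Lemma Rintegral_dominated_cvg d (T : measurableType d) (R : realType)
    (P : probability T R) (f_ : (T -> R)^nat) (f g : T -> R) :
  (forall n, measurable_fun setT (f_ n)) -> measurable_fun setT f ->
  {ae P, forall x, f_ n x @[n --> \oo] --> f x} ->
  P.-integrable setT (EFin \o g) ->
  {ae P, forall x n, `|f_ n x| <= g x} ->
  \int[P]_x f_ n x @[n --> \oo] --> \int[P]_x f x.
Proof.
move=> mf_ mf cf ig fg.
have [|||||fint _ cI] := @dominated_convergence _ T R P setT measurableT
  (fun n x => (f_ n x)%:E) (EFin \o f) (EFin \o g).
- by move=> n; exact/measurable_EFinP.
- exact/measurable_EFinP.
- by apply: filterS cf => x h _; apply: cvg_EFin => //; exact: nearW.
- exact: ig.
- by apply: filterS fg => x h n _; rewrite lee_fin.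
by apply: fine_cvg; rewrite /Rintegral fineK//; exact: integrable_fin_num.
Qed.

(** * Truncation and estimates for the logarithm *)

Definition clip (R : realType) (m M t : R) := Num.max m (Num.min M t).

Lemma clip_bounds (R : realType) (m M t : R) : m <= M -> m <= clip m M t <= M.
Proof. by move=> mM; rewrite /clip le_max lexx ge_max mM ge_min lexx. Qed.

Lemma clip_id (R : realType) (m M t : R) : m <= t <= M -> clip m M t = t.
Proof. by move=> /andP[mt tM]; rewrite /clip (min_idPr tM) (max_idPr mt). Qed.

(** Consequently, clipping an approximant takes it no further from a function that already has
    values in the interval. *)
Lemma clip_dist (R : realType) (m M s t : R) :
  `|clip m M s - clip m M t| <= `|s - t|.
Proof.
wlog st : s t / t <= s.
  move=> h; have [st|/ltW st] := leP t s; first exact: h.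
  by rewrite distrC [leRHS]distrC; exact: h.
rewrite (ger0_norm (_ : 0 <= s - t)) ?subr_ge0// ler_norml /clip.
by case: (leP M s) => ?; case: (leP M t) => ?; case: (leP m _) => ?;
  try (case: (leP m _) => ?); apply/andP; split; lra.
Qed.

Lemma measurable_clip d (T : measurableType d) (R : realType) (m M : R)
    (f : T -> R) :
  measurable_fun setT f -> measurable_fun setT (fun x => clip m M (f x)).
Proof. by move=> mf; apply: measurable_maxr => //; exact: measurable_minr. Qed.

(** Since [M^-1 <= 1 <= M], clipping moves [t] towards [1] and its logarithm towards [0]. This
    provides the majorant [|G ln G|] for the truncations. *)
Lemma ln_clip_le (R : realType) (M t : R) : 1 <= M -> 0 < t ->
  `|ln (clip M^-1 M t)| <= `|ln t|.
Proof.
move=> M1 t0; have M0 : 0 < M by lra.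
have V1 : M^-1 <= 1 by rewrite invf_le1.
have V0 : 0 < M^-1 by rewrite invr_gt0.
have lnM0 : 0 <= ln M by rewrite ln_ge0.
rewrite /clip; case: (leP M t) => h1.
  rewrite (max_idPr (le_trans V1 M1)).
  rewrite (ger0_norm lnM0) (le_trans _ (ler_norm _))// ler_ln ?posrE//.
case: (leP M^-1 t) => // h2.
rewrite lnV ?posrE// normrN (ger0_norm lnM0) -normrN -lnV ?posrE//.
rewrite (le_trans _ (ler_norm _))// ler_ln ?posrE ?invr_gt0//.
by rewrite -[leLHS]invrK lef_pV2 ?posrE ?invr_gt0// ltW.
Qed.

(** For [t <= s], [ln s - ln t = ln (1 + (s - t) / t) <= (s - t) / t], and [t >= m]. *)
Lemma ln_dist_le (R : realType) (m s t : R) : 0 < m -> m <= s -> m <= t ->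
  `|ln s - ln t| <= m^-1 * `|s - t|.
Proof.
wlog st : s t / t <= s.
  move=> h m0 ms mt; have [st|/ltW st] := leP t s; first exact: h.
  by rewrite distrC [in leRHS]distrC; exact: h.
move=> m0 ms mt; have t0 : 0 < t by lra.
have s0 : 0 < s by lra.
rewrite !ger0_norm ?subr_ge0 ?ler_ln ?posrE//.
rewrite -ln_div ?posrE//.
have -> : s / t = 1 + (s - t) / t by field; rewrite gt_eqF.
have h : 0 <= (s - t) / t by rewrite divr_ge0 ?subr_ge0// ltW.
apply: (le_trans (le_ln1Dx _)); first by lra.
by rewrite mulrC ler_wpM2r ?subr_ge0// lef_pV2 ?posrE.
Qed.

(** The function [G] is truncated to [V n], which is approximated by some [U] in [F], and then [n]
    tends to infinity. The weight [1 + |G|] controls the errors in [E[U]] and in [E[G ln U]] at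
    once. *)
Lemma entropy_le_of_dense d (T : measurableType d) (R : realType)
    (P : probability T R) (F : set (T -> R)) (G : T -> R) (r : R) :
  P.-integrable setT (EFin \o G) -> {ae P, forall x, 0 < G x} ->
  P.-integrable setT (EFin \o (fun x => G x * ln (G x))) ->
  (forall u, F u -> bounded_measurable u) ->
  (forall u m M, F u -> F (fun x => clip m M (u x))) ->
  (forall (f : T -> R) M, measurable_fun setT f -> (forall x, 0 <= f x <= M) ->
    approximable P (fun x => 1 + `|G x|) F f) ->
  (forall U m M, F U -> 0 < m -> (forall x, m <= U x <= M) ->
    \int[P]_x (G x * ln (U x)) <= (\int[P]_x G x) * ln (\int[P]_x U x) + r) ->
  \int[P]_x (G x * ln (G x)) <= (\int[P]_x G x) * ln (\int[P]_x G x) + r.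
Proof.
move=> iG G0 iGlnG Fb Fclip Fd hF.
have mG : measurable_fun setT G.
  by apply/measurable_EFinP; exact: measurable_int iG.
have EG0 : 0 < \int[P]_x G x by exact: Rintegral_gt0.
pose W x := 1 + `|G x|.
have iW : P.-integrable setT (EFin \o W).
  exact: (integrableD measurableT
    (finite_measure_integrable_cst P 1 measurableT) (integrable_abse iG)).
pose M n : R := n.+1%:R.
have M1 n : 1 <= M n by rewrite ler1n.
have M0 n : 0 < M n by exact: lt_le_trans (M1 n).
have V0 n : 0 < (M n)^-1 by rewrite invr_gt0.
have V1 n : (M n)^-1 <= 1 by rewrite invf_le1.
have VM n : (M n)^-1 <= M n by exact: le_trans (M1 n).
pose V n x := clip (M n)^-1 (M n) (G x).
have mV n : measurable_fun setT (V n) by exact: measurable_clip.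
have Vb n x : (M n)^-1 <= V n x <= M n by exact: clip_bounds.
have iU (U : T -> R) (m K : R) :
    measurable_fun setT U -> 0 < m -> (forall x, m <= U x <= K) ->
    P.-integrable setT (EFin \o U).
  move=> mU m0 hU; apply: (@integrable_bounded _ _ _ _ _ K) => // x.
  by rewrite ger0_norm; have := hU x; lra.
have step n : \int[P]_x (G x * ln (V n x)) <=
    (\int[P]_x G x) * ln (\int[P]_x (V n x) + (M n)^-1) + (r + (M n)^-1).
  have V0b x : 0 <= V n x <= M n 
    by have /andP[h1 ->] := Vb n x; rewrite andbT (le_trans _ h1)// ltW.
  (* The tolerance is [M^-2] because [ln] has Lipschitz constant [M] on the values at least [M^-1];
     the error left in [E[G ln U]] is then [M^-1]. *)
  have [bV /(_ ((M n)^-1 * (M n)^-1) (mulr_gt0 (V0 n) (V0 n))) [U' FU' hU']] :=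
    Fd _ _ (mV n) V0b.
  (* The approximant [U'] may leave the interval, where [hF] does not apply; clipping brings it back
     without leaving [F]. *)
  pose U x := clip (M n)^-1 (M n) (U' x).
  have FU : F U by exact: Fclip.
  have [mU' _] := Fb _ FU'.
  have mU : measurable_fun setT U by exact: measurable_clip.
  have Ub x : (M n)^-1 <= U x <= M n by exact: clip_bounds.
  have VU x : `|V n x - U x| <= `|V n x - U' x|.
    by rewrite -{1}(clip_id (Vb n x)); exact: clip_dist.
  have iWVU := integrable_weighted_dist iW bV (Fb _ FU').
  have iV := iU _ _ _ (mV n) (V0 n) (Vb n).
  have iU1 := iU _ _ _ mU (V0 n) Ub.
  have iGV := integrableM_ln iG (mV n) (V0 n) (Vb n).
  have iGU := integrableM_ln iG mU (V0 n) Ub.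
  have EU : \int[P]_x U x <= \int[P]_x V n x + (M n)^-1.
    apply: (@le_trans _ _ (\int[P]_x (V n x + W x * `|V n x - U' x|))).
      apply: le_Rintegral => //; first exact: (integrableD measurableT iV iWVU).
      move=> x _; have h : `|V n x - U x| <= W x * `|V n x - U' x|.
        apply: le_trans (VU x) _; rewrite /W mulrDl mul1r lerDl mulr_ge0//.
      by rewrite distrC in h; have := le_trans (ler_norm _) h; lra.
    rewrite RintegralD// lerD2l (le_trans (ltW hU'))// -[leRHS]mulr1.
    by rewrite ler_wpM2l// ltW.
  have EU0 : 0 < \int[P]_x U x.
    apply: (lt_le_trans (V0 n)).
    have -> : (M n)^-1 = \int[P]_x (cst (M n)^-1 x).
      rewrite Rintegral_cst//; transitivity ((M n)^-1 * fine (1%E : \bar R));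
        first by rewrite mulr1.
      by congr (_ * fine _); exact/esym/probability_setT.
    apply: le_Rintegral => //; first exact: finite_measure_integrable_cst.
    by move=> x _; have /andP[] := Ub x.
  have EGlnV : \int[P]_x (G x * ln (V n x)) <=
      \int[P]_x (G x * ln (U x)) + (M n)^-1.
    apply: (@le_trans _ _ (\int[P]_x (G x * ln (U x) +
        M n * (W x * `|V n x - U' x|)))).
      apply: le_Rintegral => //.
        exact: (integrableD measurableT iGU (integrableZl measurableT (M n) iWVU)).
      move=> x _; rewrite -lerBlDl -mulrBr.
      apply: (le_trans (ler_norm _)); rewrite normrM.
      have h := ln_dist_le (V0 n) (proj1 (andP (Vb n x))) (proj1 (andP (Ub x))).
      rewrite invrK in h.
      (* Here [|G| <= W], and the logarithms differ by at most [M n] times the distance. *)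
      apply: (@le_trans _ _ (W x * (M n * `|V n x - U' x|))).
        apply: ler_pM => //; first by rewrite /W lerDr.
        by apply: (le_trans h); rewrite ler_wpM2l// ltW.
      by rewrite mulrCA.
    rewrite RintegralD//; last exact: (integrableZl measurableT (M n) iWVU).
    rewrite RintegralZl// lerD2l -(ler_pM2l (V0 n)) mulrA mulVf ?gt_eqF// mul1r.
    exact: ltW.
  apply: (le_trans EGlnV); rewrite addrA lerD2r.
  apply: (le_trans (hF _ _ _ FU (V0 n) Ub)); rewrite lerD2r ler_pM2l//.
  rewrite ler_ln ?posrE//; exact: lt_le_trans EU.
have M_cvg : (M n)^-1 @[n --> \oo] --> (0 : R) by exact: cvg_harmonic.
(* Where [G x > 0], the truncation is inactive as soon as [n] exceeds both [G x] and its inverse. *)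
have cV : {ae P, forall x, V n x @[n --> \oo] --> G x}.
  apply: filterS G0 => x Gx; apply: cvg_near_cst.
  have [N _ hN] := nbhs_infty_ger (Num.max (G x) (G x)^-1).
  exists N => // n /= /hN /=; rewrite ge_max => /andP[h1 h2]; apply: clip_id.
  have h3 : n%:R <= M n by rewrite ler_nat.
  rewrite (le_trans h1 h3) andbT -[leRHS]invrK lef_pV2 ?posrE ?invr_gt0//.
  exact: le_trans h3.
have cEV : \int[P]_x V n x @[n --> \oo] --> \int[P]_x G x.
  (* The majorant is [W]: [V n] is at most the maximum of [1] and [G]. *)
  apply: (Rintegral_dominated_cvg mV mG cV iW).
  apply: aeW => x n; have /andP[h1 h2] := Vb n x.
  rewrite ger0_norm; last by apply: le_trans h1; exact: ltW.
  rewrite /V /clip /W ge_max (le_trans (V1 n)) ?lerDl//= ge_min.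
  by rewrite (le_trans (ler_norm (G x))) ?orbT// lerDr.
have cGV : \int[P]_x (G x * ln (V n x)) @[n --> \oo] --> \int[P]_x (G x * ln (G x)).
  apply: (Rintegral_dominated_cvg _ _ _ (integrable_abse iGlnG)).
  - by move=> n; apply: measurable_funM => //; exact: measurableT_comp.
  - by apply: measurable_funM => //; exact: measurableT_comp.
  - apply: filterS2 G0 cV => x Gx cx; apply: cvgMr.
    by apply: continuous_cvg cx; exact: continuous_ln.
  - apply: filterS G0 => x Gx n /=; rewrite !normrM ler_wpM2l//.
    exact: ln_clip_le.
apply: (ler_cvg_to cGV _ (nearW _ step)).
rewrite -[X in _ --> _ * ln X + _]addr0 -[r in X in _ --> X]addr0.
apply: cvgD; last by apply: cvgD => //; exact: cvg_cst.
apply: cvgMr; apply: continuous_cvg.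
  by apply: continuous_ln; rewrite addr0.
exact: cvgD.
Qed.

(** * Product spaces *)

Definition resample (A : countType) (E : A -> ptopologicalType) (k : A)
  (z : prod_space E * borel (E k)) : prod_space E := dfwith z.1 k z.2.

Definition depends_on (A : countType) (E : A -> ptopologicalType) (T : Type)
    (s : seq A) (U : prod_space E -> T) :=
  forall x y : prod_space E, (forall a, a \in s -> x a = y a) -> U x = U y.

Definition cylinder (A : countType) (E : A -> ptopologicalType)
    (J : {fset A}) (B : forall a, set (borel (E a))) : set (prod_space E) :=
  [set x | forall a, a \in J -> B a (x a)].

(** This pi-system serves twice: to identify measures on the product, and to approximate functions
    by those of finitely many coordinates. *)
Definition cylinders (A : countType) (E : A -> ptopologicalType) :
    set (set (prod_space E)) :=
  [set S | exists (J : {fset A}) (B : forall a, set (borel (E a))),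
    (forall a, measurable (B a)) /\ S = cylinder J B].

Lemma measurable_coord (A : countType) (E : A -> ptopologicalType) (a : A) :
  measurable_fun setT ((fun x => x a) : prod_space E -> borel (E a)).
Proof.
move=> _ B mB; apply: sub_sigma_algebra; exists a => //.
by exists B.
Qed.

Lemma measurable_cylinder (A : countType) (E : A -> ptopologicalType)
    (J : {fset A}) (B : forall a, set (borel (E a))) :
  (forall a, measurable (B a)) -> measurable (cylinder J B).
Proof.
move=> mB.
have -> : cylinder J B = \bigcap_(a in [set` J]) ((fun x => x a) @^-1` B a).
  by apply/seteqP; split => x /= h a; exact: h.
apply: fin_bigcap_measurable => // a _.
by rewrite -[X in measurable X]setTI; exact: measurable_coord.
Qed.

Lemma cylinders_setI (A : countType) (E : A -> ptopologicalType) :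
  setI_closed (@cylinders A E).
Proof.
move=> _ _ [J1 [B1 [mB1 ->]]] [J2 [B2 [mB2 ->]]].
(* A coordinate outside one of the two index sets gets the trivial constraint [setT] from that
   side. *)
exists (J1 `|` J2)%fset, (fun a => (if a \in J1 then B1 a else setT) `&`
  (if a \in J2 then B2 a else setT)); split.
  by move=> a; apply: measurableI; case: ifP.
apply/seteqP; split => x /=.
  by move=> [h1 h2] a _; split; case: ifPn => //; [exact: h1|exact: h2].
move=> h; split => a aJ.
  by have := h a; rewrite inE aJ /= => /(_ isT)[].
by have := h a; rewrite inE aJ orbT /= => /(_ isT)[].
Qed.

Lemma measurable_cylindersE (A : countType) (E : A -> ptopologicalType) :
  (measurable : set (set (prod_space E))) = <<s @cylinders A E >>.
Proof.
apply/seteqP; split.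
  apply: smallest_sub; first exact: smallest_sigma_algebra.
  move=> S [a _ [B mB <-]]; apply: sub_sigma_algebra.
  (* A family over all coordinates is required: [B] is transported along [b = a] and the other
     entries are [setT]. Proof irrelevance removes the transport at [a] itself. *)
  exists [fset a]%fset, (fun b => if pselect (b = a) is left e
     then ecast b (set (borel (E b))) (esym e) B else setT); split.
    move=> b; case: pselect => //= e.
    by move: (esym e) => {}e; case: _ / e.
  rewrite setTI; apply/seteqP; split => x /=.
    move=> h b; rewrite inE => /eqP ->; case: pselect => // e.
    by rewrite (Prop_irrelevance e (erefl a)).
  move=> /(_ a); rewrite inE eqxx => /(_ isT).
  by case: pselect => // e; rewrite (Prop_irrelevance e (erefl a)).
apply: smallest_sub; first exact: sigma_algebra_measurable.
by move=> _ [J [B [mB ->]]]; exact: measurable_cylinder.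
Qed.

(** It suffices to treat an event on one coordinate [a]. Its preimage is a rectangle that constrains
    only the new value if [a = k], and only the old point otherwise. *)
Lemma measurable_resample (A : countType) (E : A -> ptopologicalType) (k : A) :
  measurable_fun setT (@resample A E k).
Proof.
apply: (@measurability _ _ (prod_space E * borel (E k))%type (prod_space E)
  _ _ (coord_events E setT)) => //.
move=> _ [_ [a _ [B mB <-]] <-]; rewrite !setTI.
have [eka|ka] := pselect (k = a).
  case: _ / eka B mB => B mB.
  rewrite (_ : _ @^-1` _ = setT `*` B); first exact: measurableX.
  by apply/seteqP; split => -[x y] /=; rewrite /proj /resample/= dfwithin; tauto.
rewrite (_ : _ @^-1` _ = (fun x => x a) @^-1` B `*` setT).
  apply: measurableX => //; rewrite -[X in measurable X]setTI.
  exact: measurable_coord.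
by apply/seteqP; split => -[x y] /=;
  (rewrite /proj /resample/= dfwithout; [tauto|exact/eqP]).
Qed.

Lemma resample_cylinder (A : countType) (E : A -> ptopologicalType) (k : A)
    (J : {fset A}) (B : forall a, set (borel (E a))) :
  @resample A E k @^-1` (cylinder J B) =
  cylinder (J `\ k)%fset B `*` (if k \in J then B k else setT).
Proof.
apply/seteqP; split => -[x y]; rewrite /cylinder /resample /=.
  move=> h; split=> [a|].
    by rewrite !inE => /andP[ak /h]; rewrite dfwithout// eq_sym.
  by case: ifPn => // /h; rewrite dfwithin.
move=> [h1 h2] a aJ; have [eka|ka] := eqVneq k a.
  by move: aJ h2; case: _ / eka => ->; rewrite dfwithin.
by rewrite dfwithout //; apply: h1; rewrite !inE eq_sym ka.
Qed.

(** Two finite measures that agree on a generating pi-system are equal. On a cylinder both sides are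
    the product of the [Pa a (B a)], with the factor at [k] split off on the right. *)
Lemma pushforward_resample (R : realType) (A : countType)
    (E : A -> ptopologicalType) (Pa : forall a, probability (borel (E a)) R)
    (P : probability (prod_space E) R) (hP : is_product_measure Pa P)
    (k : A) (S : set (prod_space E)) : measurable S ->
  P S = (P \x Pa k)%E (@resample A E k @^-1` S).
Proof.
move=> mS.
have mr := @measurable_resample A E k.
apply: (@measure_unique _ _ _ (@cylinders A E) (fun=> setT) _ _ _ _
  P (pushforward (P \x Pa k)%E (@resample A E k))) => //.
- exact: measurable_cylindersE.
- exact: cylinders_setI.
- move=> _; exists fset0, (fun=> setT); split => //.
  by apply/seteqP; split.
- by rewrite bigcup_const //; exists 0%N.
- move=> _ [J [B [mB ->]]].
  rewrite -[RHS]/((P \x Pa k)%E (@resample A E k @^-1` cylinder J B)).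
  rewrite resample_cylinder product_measure1E; last 2 first.
  + exact: measurable_cylinder.
  + by case: ifP.
  have hPc I : P (cylinder I B) = (\prod_(a <- I) Pa a (B a))%E by exact: hP.
  apply: (etrans (hPc J)).
  transitivity ((\prod_(a <- (J `\ k)%fset) Pa a (B a)) *
      Pa k (if k \in J then B k else setT))%E; last first.
    by congr (_ * _)%E; exact/esym/hPc.
  (* If [k] is not in [J], the extra factor is [Pa k setT = 1]. *)
  case: ifPn => kJ; first by rewrite (big_fsetD1 k)//= muleC.
  have -> : Pa k setT = 1%E by exact: (probability_setT (Pa k)).
  by rewrite mule1 mem_fsetD1.
- have PT : P setT = 1%E by exact: (probability_setT P).
  move=> _; apply: (@le_lt_trans _ _ 1%E); last exact: ltry.
  by rewrite -PT.
Qed.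

(** The sets insensitive to the coordinate [k] form a sigma-algebra that contains every event on
    another coordinate. *)
Lemma sigma_but_dfwith (A : countType) (E : A -> ptopologicalType) (k : A)
    (S : set (prod_space E)) : sigma_but E k S ->
  forall (x : prod_space E) (y : E k), S (dfwith x k y) = S x.
Proof.
move: S; apply: smallest_sub.
  split.
  - by move=> x y.
  - by move=> S h x y; rewrite /setD/= h.
  - move=> F h x y; rewrite /bigcup /=; apply/propext; split => -[n _].
      by rewrite (h n); exists n.
    by rewrite -(h n x y); exists n.
move=> _ [a /= /eqP ak [B mB <-]] x y; rewrite setTI /preimage /proj/=.
by rewrite dfwithout // eq_sym.
Qed.

Lemma sigma_but_measurable (A : countType) (E : A -> ptopologicalType) (k : A)
    (S : set (prod_space E)) : sigma_but E k S -> measurable S.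
Proof.
apply: sub_smallest2r; first exact: smallest_sigma_algebra.
by move=> T [a _ h]; exists a.
Qed.

(** The level set of [C] through [x] belongs to [sigma_but E k], so changing the coordinate [k] does
    not leave it. The invariance thus holds at every point. *)
Lemma cond_exp_dfwith (R : realType) (A : countType)
    (E : A -> ptopologicalType)
    (P : probability (prod_space E) R) (k : A) (G C : prod_space E -> R) :
  is_cond_exp P (sigma_but E k) G C ->
  forall (x : prod_space E) (y : E k), C (dfwith x k y) = C x.
Proof.
move=> [_ mC _] x y.
have := sigma_but_dfwith (mC _ (measurable_set1 (C x))) x y.
by rewrite /preimage/= => ->.
Qed.

Lemma resampling_coord (R : realType) (A : countType)
    (E : A -> ptopologicalType) (Pa : forall a, probability (borel (E a)) R)
    (P : probability (prod_space E) R) (k : A) :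
  is_product_measure Pa P -> resampling P (Pa k) (@resample A E k).
Proof.
move=> hP; split.
- exact: measurable_resample.
- by move=> S mS; exact: pushforward_resample.
- move=> x y z; apply: functional_extensionality_dep => a; rewrite /resample/=.
  have [<-|ka] := eqVneq k a; first by rewrite !dfwithin.
  by rewrite !dfwithout.
Qed.

(** * Telescoping over the coordinates and the inequality *)

Lemma depends_on_average (R : realType) (A : countType)
    (E : A -> ptopologicalType) (Pa : forall a, probability (borel (E a)) R)
    (k : A) (s : seq A) (U : prod_space E -> R) :
  depends_on (k :: s) U -> depends_on s (average (Pa k) (@resample A E k) U).
Proof.
move=> hU x y xy; apply: eq_Rintegral => z _; apply: hU => a.
rewrite inE /resample/= => /orP[/eqP ->|as_]; first by rewrite !dfwithin.
have [<-|ka] := eqVneq k a; first by rewrite !dfwithin.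
by rewrite !dfwithout// xy.
Qed.

(** By induction on [s]: averaging out the head coordinate costs one term of the sum and leaves a
    function of the remaining coordinates with the same bounds and the same mean. *)
Lemma entropy_telescope (R : realType) (A : countType)
    (E : A -> ptopologicalType) (Pa : forall a, probability (borel (E a)) R)
    (P : probability (prod_space E) R) (G : prod_space E -> R)
    (C : A -> prod_space E -> R) :
  is_product_measure Pa P ->
  P.-integrable setT (EFin \o G) -> {ae P, forall x, 0 < G x} ->
  (forall k, P.-integrable setT (EFin \o C k)) ->
  (forall k, {ae P, forall x, 0 < C k x}) ->
  (forall k (x : prod_space E) y, C k (dfwith x k y) = C k x) ->
  forall (s : seq A) (U : prod_space E -> R) (m M : R),
  measurable_fun [set: prod_space E] U -> 0 < m -> (forall x, m <= U x <= M) ->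
  depends_on s U ->
  (\int[P]_x (G x * ln (U x))%:E <=
   ((\int[P]_x G x)%R * ln (\int[P]_x U x)%R)%:E +
   \sum_(k <- s) \int[P]_x (`|G x - C k x| ^+ 2 / C k x)%:E)%E.
Proof.
move=> hP iG G0 iC C0 hC; elim=> [|k s IHs] U m M mU m0 hU dU.
  (* A function of no coordinates is constant, and then equality holds. *)
  have [c Uc] : exists c, forall x, U x = c.
    by exists (U point) => x; exact: dU.
  rewrite big_nil adde0.
  have -> : \int[P]_x U x = c.
    transitivity (\int[P]_x (cst c x)); first by apply: eq_Rintegral => x _.
    rewrite Rintegral_cst//; transitivity (c * fine (1%E : \bar R)).
      by congr (_ * fine _); exact: probability_setT.
    by rewrite mulr1.
  under eq_integral do rewrite Uc EFinM.
  rewrite integralZr// EFinM /Rintegral fineK//.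
  exact: integrable_fin_num.
have hr := resampling_coord k hP.
set r := @resample A E k in hr.
pose U' := average (Pa k) r U.
have hU' x : m <= U' x <= M by exact: average_bounds hr mU (ltW m0) hU.
have hU0 x : 0 <= U x <= M by have := hU x; lra.
have mU' : measurable_fun [set: prod_space E] U'.
  by apply: (measurable_average hr mU) => x; have /andP[] := hU0 x.
(* Averaging preserves the mean: this is [integral_invariantM] with [W = 1]. *)
have EU : \int[P]_x U x = \int[P]_x U' x.
  have h : (\int[P]_x (1 * U x)%:E = \int[P]_x (1 * U' x)%:E)%E.
    by apply: (@integral_invariantM _ _ _ _ _ _ _ _ U (fun=> 1) M hr mU hU0).
  rewrite /Rintegral; under eq_integral do rewrite -(mul1r (U _)).
  by rewrite h; congr fine; apply: eq_integral => x _; rewrite mul1r.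
have IH := IHs U' m M mU' m0 hU' (depends_on_average Pa dU).
have -> : (\int[P]_x (G x * ln (U x))%:E =
    \int[P]_x (G x * (ln (U x) - ln (U' x)))%:E +
    \int[P]_x (G x * ln (U' x))%:E)%E.
  under [X in (_ = X + _)%E]eq_integral do rewrite mulrBr EFinB.
  rewrite integralB//; first last.
  - exact: integrableM_ln iG mU' m0 hU'.
  - exact: integrableM_ln iG mU m0 hU.
  rewrite subeK//; apply: integrable_fin_num => //.
  exact: integrableM_ln iG mU' m0 hU'.
rewrite big_cons EU [leRHS]addeCA; apply: leeD; last exact: IH.
by apply: (entropy_step hr iG G0 (iC k) (C0 k) _ mU m0 hU) => x y; exact: hC.
Qed.

Theorem theorem3p9 (R : realType) (A : countType) (E : A -> ptopologicalType)
  (hE : forall a, polish R (E a))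
  (Pa : forall a, probability (borel (E a)) R)
  (P : probability (prod_space E) R) (hP : is_product_measure Pa P)
  (G : {RV P >-> R})
  (Gpos : {ae P, forall x, 0 < G x}) (GLlogL : LlogL P G)
  (C : A -> prod_space E -> R)
  (hC : forall k, is_cond_exp P (sigma_but E k) G (C k)) :
  ('E_P[(fun x => G x * ln (G x))%R] - 'E_P[G] * lne 'E_P[G] <=
   \esum_(k in [set: A])
     'E_P[(fun x => `|gradient G (C k) x| ^+ 2 / C k x)%R])%E.
Proof.
have [iG iGlnG] := GLlogL.
have mG : measurable_fun [set: prod_space E] G.
  by apply/measurable_EFinP; exact: measurable_int iG.
have iC k : P.-integrable setT (EFin \o C k) by have [] := hC k.
(* The event [C k <= 0] lies in [sigma_but E k], so [G] and [C k] have the same integral over it.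
   This integral is at most [0] while [G > 0], so the event is null. *)
have C0 k : {ae P, forall x, 0 < C k x}.
  have [_ hm hI] := hC k.
  have hS := hm `]-oo, 0]%classic (measurable_itv _).
  have mS := sigma_but_measurable hS.
  have := ae_notin_of_integral_le0 mS mG Gpos; rewrite -hI//.
  have Ile : (\int[P]_(x in C k @^-1` `]-oo, 0%R]%classic) (C k x)%:E <= 0)%E.
    rewrite -(integral0 P (C k @^-1` `]-oo, 0%R]%classic)).
    apply: le_integral => //; first exact: integrableS (iC k).
      exact: integrable0.
    by move=> x; rewrite inE /= in_itv/= lee_fin.
  move=> /(_ Ile); apply: filterS => x.
  by rewrite /= in_itv /= => /negP; rewrite ltNge.
pose F := [set U : prod_space E -> R | bounded_measurable U /\
  exists s : seq A, depends_on s U].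
pose tau k := (\int[P]_x (`|G x - C k x| ^+ 2 / C k x)%:E)%E.
rewrite unlock -[X in (_ <= X)%E]/(\esum_(k in [set: A]) tau k)%E.
set rhs := (\esum_(k in _) _)%E.
have sum_le (s : seq A) : uniq s -> (\sum_(k <- s) tau k <= rhs)%E.
  move=> us; apply: esum_ge; exists [set` s].
    by split => //; exact: finite_seq.
  by rewrite fsbig_seq.
have EG := fineK (integrable_fin_num measurableT iG).
have EGlnG := fineK (integrable_fin_num measurableT iGlnG).
(* The inequality is proved against real upper bounds [r] of [rhs], which may itself be infinite. *)
have key (r : R) : (rhs <= r%:E)%E ->
    \int[P]_x (G x * ln (G x)) <= (\int[P]_x G x) * ln (\int[P]_x G x) + r.
  move=> hr; apply: (@entropy_le_of_dense _ _ _ P F G r iG Gpos iGlnG).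
  - by move=> u [].
  - move=> u m M [[mu [K hK]] [s hs]]; split.
      split; first exact: measurable_clip.
      exists (`|m| + `|M| + K) => x; have := ler_norm (u x).
      have := ler_norm m; have := ler_norm M; have := hK x.
      have := ler_norm (- m); have := ler_norm (- M); have := ler_norm (- u x).
      have := normr_ge0 m; have := normr_ge0 M; have := normr_ge0 (u x).
      rewrite !normrN /clip => *; rewrite ler_norml.
      by case: (leP M (u x)) => ?; case: (leP m _) => ?; apply/andP; split; lra.
    by exists s => x y xy; rewrite (hs x y).
  - move=> f M mf hf.
    apply: (approximable_bounded (G := @cylinders A E) _ _ _ _ _ _ _ _ mf hf).
    + exact: (integrableD measurableT
        (finite_measure_integrable_cst P 1 measurableT) (integrable_abse iG)).
    + by move=> x; rewrite addr_ge0.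
    + by move=> u [].
    + move=> u v c [bu [s hs]] [bv [t ht]]; split; first exact: bounded_measurableD.
      exists (s ++ t) => x y xy; congr (_ + _ * _).
        by apply: hs => a sa; apply: xy; rewrite mem_cat sa.
      by apply: ht => a sa; apply: xy; rewrite mem_cat sa orbT.
    + exact: measurable_cylindersE.
    + exact: cylinders_setI.
    + by exists fset0, (fun=> setT); split => //; apply/seteqP; split.
    + move=> _ [J [B [mB ->]]]; split.
        split; first (apply: measurable_indic; exact: measurable_cylinder).
        by exists 1 => x; rewrite indicE ger0_norm ?ler0n// lern1 leq_b1.
      exists J => x y xy; rewrite !indicE; congr (_%:R); congr (nat_of_bool _).
      apply/idP/idP; rewrite !inE => h a aJ; [rewrite -xy//|rewrite xy//]; exact: h.
  - move=> U m M [[mU _] [s hs]] m0 hU.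
    rewrite -lee_fin.
    (* Duplicates are removed so that each coordinate contributes at most once, as [sum_le]
       requires. *)
    have hs' : depends_on (undup s) U.
      by move=> x y xy; apply: hs => a sa; apply: xy; rewrite mem_undup.
    have h := entropy_telescope hP iG Gpos iC C0
      (fun k => cond_exp_dfwith (hC k)) mU m0 hU hs'.
    have iGlnU : P.-integrable setT (EFin \o (fun x => G x * ln (U x))).
      exact: integrableM_ln iG mU m0 hU.
    have := le_trans h (leeD2l _ (le_trans (sum_le _ (undup_uniq s)) hr)).
    by rewrite -(fineK (integrable_fin_num measurableT iGlnU)) lee_fin.
have rhs0 : (0 <= rhs)%E by have := sum_le [::] isT; rewrite big_nil.
have EG0 : 0 < \int[P]_x G x by exact: Rintegral_gt0.
rewrite -EGlnG -EG lne_EFin// -EFinM -EFinB.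
(* A real [rhs] is its own bound [r]; for [+oo] the claim is trivial, and [rhs0] excludes [-oo]. *)
move: rhs0 key; case: rhs {sum_le} => [r| |//] _ key; last exact: leey.
by rewrite lee_fin lerBlDl; exact: key.
Qed.
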